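(* Let $\theta=\mathbf{1}_n$. Let $d=\frac{c(n-N)^2-aN^2}{n(n-2N)}$ and $b=\frac{nc-(a+c)N}{n-2N}$. Under $H_0$ the upper-triangular entries of $A$ are i.i.d. $\mathrm{Bernoulli}(d)$. Under $H_1$, $X_1,\dots,X_n$ are i.i.d. $\mathrm{Bernoulli}(N/n)$ and, conditionally on them, the upper-triangular entries of $A$ are independent with $\mathbb{P}(A_{ij}=1)=a$ if $X_i=X_j=1$, $c$ if $X_i=X_j=0$, and $b$ otherwise. Suppose, as $n\to\infty$, $0<c<a$, $c<1-\delta$ for a constant $\delta>0$, $b\ge0$, $N<n/3$, $D=O(\log n)$, and $$\limsup_{n\to\infty}\Big\{\Big(\log_n\tfrac{N}{\sqrt n}+\log_n\tfrac{a-c}{\sqrt c}\Big)\vee\Big(\sqrt{D/2-1}\,\log_n\tfrac{a-c}{\sqrt c}\Big)\Big\}<0.$$ Then for any sequence of polynomials $\phi_n$ of degree at most $D$ in the entries $\{A_{ij}\}_{i<j}$ with $\mathbb{E}_{H_0}\phi_n(A)=0$ and $\mathrm{Var}_{H_0}(\phi_n(A))=1$, we have $\mathbb{E}_{H_1}\phi_n(A)=o(1)$; indeed the supremum of $\mathbb{E}_{H_1}\phi_n(A)$ over all such polynomials is $o(1)$.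
   Context: $A$ is symmetric with zero diagonal; $\log_n x=\log x/\log n$. *)

(* Defs.v *)
From HB Require Import structures.
From mathcomp Require Import all_boot all_order all_algebra.
From mathcomp Require Import all_classical all_reals all_analysis.
Set Implicit Arguments. Unset Strict Implicit. Unset Printing Implicit Defensive.
Import Order.TTheory GRing.Theory Num.Theory.
Local Open Scope ring_scope.

Definition edge (n : nat) := {p : 'I_n * 'I_n | (p.1 < p.2)%N}.

(* A (symmetric, zero-diagonal) adjacency matrix is determined by its
   upper-triangular entries. *)
Definition graph (n : nat) := {ffun edge n -> bool}.

Section Defs.
Variable R : realType.

Definition logn_ (n : nat) (x : R) : R := ln x / ln n%:R.

Definition bern (p : R) (x : bool) : R := if x then p else 1 - p.

Definition d_par (n : nat) (a c N : R) : R :=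
  (c * (n%:R - N) ^+ 2 - a * N ^+ 2) / (n%:R * (n%:R - 2 * N)).

Definition b_par (n : nat) (a c N : R) : R :=
  (n%:R * c - (a + c) * N) / (n%:R - 2 * N).

Definition P0 (n : nat) (a c N : R) (A : graph n) : R :=
  \prod_(e : edge n) bern (d_par n a c N) (A e).

Definition edge_prob (a b c : R) (x y : bool) : R :=
  if x && y then a else if ~~ x && ~~ y then c else b.

Definition P1 (n : nat) (a c N : R) (A : graph n) : R :=
  \sum_(X : {ffun 'I_n -> bool})
     (\prod_(i : 'I_n) bern (N / n%:R) (X i)) *
     \prod_(e : edge n)
        bern (edge_prob a (b_par n a c N) c (X (val e).1) (X (val e).2)) (A e).

Definition expect (n : nat) (P : graph n -> R) (f : graph n -> R) : R :=
  \sum_(A : graph n) P A * f A.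

Definition variance (n : nat) (P : graph n -> R) (f : graph n -> R) : R :=
  expect P (fun A => f A ^+ 2) - (expect P f) ^+ 2.

(* f is (the evaluation of) a polynomial of degree at most D in the
   entries A_ij, i<j.  Since the entries are 0/1, every polynomial of
   degree <= D coincides on graphs with a multilinear one of degree <= D. *)
Definition poly_deg_le (n D : nat) (f : graph n -> R) : Prop :=
  exists beta : {set edge n} -> R, forall A : graph n,
    f A = \sum_(S : {set edge n} | (#|S| <= D)%N)
            beta S * \prod_(e in S) ((A e)%:R : R).

Definition admissible (n D : nat) (a c N : R) (f : graph n -> R) : Prop :=
  poly_deg_le D f /\ expect (P0 a c N) f = 0 /\ variance (P0 a c N) f = 1.

End Defs.

(* Main.v *)
Require Import Defs.
From HB Require Import structures.
From mathcomp Require Import all_boot all_order all_algebra.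
From mathcomp Require Import all_classical all_reals all_analysis.
From mathcomp Require Import ring lra.
Import Order.TTheory GRing.Theory Num.Theory.
Local Open Scope classical_set_scope.
Local Open Scope ring_scope.

(** With q = N/n, the choice of b and d makes the centred edge probability
    equal to lam (X_i - q)(X_j - q) with lam = (a - c)/(1 - 2q). In the
    P0-orthonormal basis chi_S = prod_(e in S) (A_e - d)/sqrt(d(1-d)), Parseval
    and Cauchy-Schwarz bound the square of the supremum by
    G = sum_(1 <= |S| <= D) (E_1 chi_S)^2. Here E_1 chi_S factorises over the
    vertices; it vanishes if some vertex has degree 1 in S, and otherwise its
    square is at most t^|S| q^(2|V(S)|), where t = lam^2/(d(1-d)) and
    |V(S)| <= |S|. Grouping the S by V(S), if t D <= 1 this gives
    G <= exp(e n q^2 t D) - 1. With t = O((a-c)^2/c) and D = O(log n), the first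
    term of the maximum makes n q^2 t D vanish and the second one t D. As
    sqrt(D/2 - 1) is 0 for D <= 2, the second term also forces D >= 3, so
    admissible polynomials exist and the supremum is nonnegative. *)

(** * The orthonormal basis [chi] under the null distribution *)

Definition chi {R : realType} {n : nat} (d : R) (S : {set edge n})
    (A : graph n) : R :=
  \prod_(e in S) (((A e)%:R - d) / Num.sqrt (d * (1 - d))).

Definition endpoint {n : nat} (e : edge n) (i : 'I_n) : nat :=
  ((val e).1 == i) + ((val e).2 == i).

Definition deg {n : nat} (S : {set edge n}) (i : 'I_n) : nat :=
  \sum_(e in S) endpoint e i.

(** The [k]-th central moment of a Bernoulli variable of mean [q]. *)
Definition moment {R : realType} (q : R) (k : nat) : R :=
  q * (1 - q) ^+ k + (1 - q) * (- q) ^+ k.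

(** This makes expectations under product measures factor over coordinates, both for graphs (edges)
    and for label vectors (vertices). *)
Lemma sum_prod_bool {R : realType} {I : finType} (g : I -> bool -> R) :
  \sum_(f : {ffun I -> bool}) \prod_i g i (f i) =
  \prod_i (g i true + g i false).
Proof.
rewrite -(@bigA_distr_bigA _ 0 1 *%R +%R).
by apply: eq_bigr => i _; rewrite big_bool.
Qed.

(** The expectation factors over edges. An edge in both sets or in neither contributes 1, and an
    edge in exactly one contributes the mean 0 of a centred variable. *)
Lemma expect_chiM {R : realType} {n : nat} (a c N : R) (S T : {set edge n}) :
  let d := d_par n a c N in 0 < d < 1 ->
  expect (P0 a c N) (fun A => chi d S A * chi d T A) = (S == T)%:R.
Proof.
move=> d /andP[d0 d1]; have s0 : 0 < d * (1 - d) by rewrite mulr_gt0 // subr_gt0.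
have sE : Num.sqrt (d * (1 - d)) ^+ 2 = d * (1 - d) by rewrite sqr_sqrtr // ltW.
have sn0 : Num.sqrt (d * (1 - d)) != 0 by rewrite gt_eqF // sqrtr_gt0.
pose x (b : bool) : R := (b%:R - d) / Num.sqrt (d * (1 - d)).
pose g (e : edge n) b := bern d b *
  ((if e \in S then x b else 1) * (if e \in T then x b else 1)).
have -> : expect (P0 a c N) (fun A => chi d S A * chi d T A) =
    \sum_(A : graph n) \prod_e g e (A e).
  rewrite /expect; apply: eq_bigr => A _.
  by rewrite /P0 /chi -/d (big_mkcond (mem S)) (big_mkcond (mem T)) /= -!big_split.
rewrite sum_prod_bool.
have gE e : g e true + g e false = ((e \in S) == (e \in T))%:R.
  rewrite /g /x /bern; case: (e \in S); case: (e \in T) => /=;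
    rewrite ?mulr1 ?mul1r ?eqxx /=.
  - transitivity (d * (1 - d) / Num.sqrt (d * (1 - d)) ^+ 2).
      by field.
    by rewrite sE divff // gt_eqF.
  - by field.
  - by field.
  - by ring.
rewrite (eq_bigr _ (fun e _ => gE e)).
case: eqVneq => [->|neq]; first by rewrite big1 // => e _; rewrite eqxx.
have [e neqe] : exists e, (e \in S) != (e \in T).
  apply/existsP; rewrite -negb_forall; apply: contra neq => /forallP H.
  by apply/eqP/setP => e; apply/eqP.
by rewrite (bigD1 e) //= (negbTE neqe) mul0r.
Qed.

(** Substituting [d + s x] for each entry, with [x] its normalised version, expands the monomial of
    [S] into [chi d T] with [T] inside [S] only, so the degree does not grow. *)
Lemma chi_expansion {R : realType} {n : nat} (d : R) (D : nat) (f : graph n -> R) :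
  0 < d < 1 -> poly_deg_le D f ->
  exists gam : {set edge n} -> R,
    (forall T : {set edge n}, (D < #|T|)%N -> gam T = 0) /\
    (forall A, f A = \sum_T gam T * chi d T A).
Proof.
move=> /andP[d0 d1] [beta fE]; set s := Num.sqrt (d * (1 - d)).
have sn0 : s != 0 by rewrite gt_eqF // sqrtr_gt0 mulr_gt0 // subr_gt0.
(* The coefficient of [chi d T] in the monomial of [S]: it is [s^|T| d^|S - T|] if [T] lies in [S],
   and 0 otherwise. *)
pose k (S T : {set edge n}) : R :=
  \prod_e (if e \in T then (if e \in S then s else 0)
           else (if e \in S then d else 1)).
have monoE (S : {set edge n}) (A : graph n) :
    \prod_(e in S) ((A e)%:R : R) = \sum_T k S T * chi d T A.
  rewrite big_mkcond /=.
  pose x (e : edge n) : R := ((A e)%:R - d) / s.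
  rewrite (eq_bigr (fun e => (if e \in S then s * x e else 0) +
                             (if e \in S then d else 1))); last first.
    move=> e _; case: (e \in S); last by rewrite add0r.
    by rewrite /x mulrC divfK // subrK.
  rewrite (@bigA_distr _ 0 1 *%R +%R) /=; apply: eq_bigr => T _.
  rewrite /k /chi (big_mkcond (mem T)) /= -big_split /=; apply: eq_bigr => e _.
  by case: (e \in T); case: (e \in S); rewrite /x ?mulr1 ?mul0r ?mulrA.
exists (fun T => \sum_(S : {set edge n} | (#|S| <= D)%N) beta S * k S T); split.
  move=> T DT; apply: big1 => S SD.
  have /subsetPn[e eT eS] : ~~ (T \subset S).
    by apply: contraL DT => /subset_leq_card TS; rewrite -leqNgt (leq_trans TS).
  by rewrite /k (bigD1 e) //= eT (negbTE eS) mul0r mulr0.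
move=> A; rewrite fE; under eq_bigr => S _ do rewrite monoE mulr_sumr.
rewrite exchange_big /=; apply: eq_bigr => T _; rewrite mulr_suml.
by apply: eq_bigr => S _; rewrite mulrA.
Qed.

(** * First moments of the basis under the planted distribution *)

(** Regrouping by vertices is what allows the independent labels to be averaged one at a time. *)
Lemma prod_endpoints {R : realType} {n : nat} (S : {set edge n}) (u : 'I_n -> R) :
  \prod_(e in S) (u (val e).1 * u (val e).2) = \prod_i u i ^+ deg S i.
Proof.
have pw (e : edge n) : u (val e).1 * u (val e).2 = \prod_i u i ^+ endpoint e i.
  have one j : u j = \prod_i u i ^+ (j == i).
    rewrite (bigD1 j) //= eqxx big1 ?mulr1 // => i ij.
    by rewrite eq_sym (negbTE ij).
  rewrite {1}one [X in _ * X]one -big_split /=.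
  by apply: eq_bigr => i _; rewrite exprD.
under eq_bigr => e _ do rewrite pw.
rewrite exchange_big /=; apply: eq_bigr => i _.
by rewrite /deg; elim/big_rec2: _ => [|e y k _ ->]; rewrite ?expr0 // exprD.
Qed.

(* The choice of [d_par] and [b_par] matches the conditional edge density given
   one label to [d], which forces the centred kernel to have rank one. *)
Lemma edge_prob_centred {R : realType} {n : nat} (a c N : R) (x y : bool) :
  0 < N -> N < n%:R / 3 ->
  edge_prob a (b_par n a c N) c x y - d_par n a c N =
  n%:R * (a - c) / (n%:R - 2 * N) * ((x%:R - N / n%:R) * (y%:R - N / n%:R)).
Proof.
move=> N0 Nn; have n0 : n%:R != 0 :> R by lra.
have n1 : n%:R - 2 * N != 0 by lra.
rewrite /edge_prob /b_par /d_par; case: x; case: y => /=; field; by rewrite n0 n1.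
Qed.

Lemma expect1_chi {R : realType} {n : nat} (a c N : R) (S : {set edge n}) :
  let d := d_par n a c N in 0 < N -> N < n%:R / 3 -> 0 < d < 1 ->
  expect (P1 a c N) (chi d S) =
  (n%:R * (a - c) / (n%:R - 2 * N) / Num.sqrt (d * (1 - d))) ^+ #|S| *
  \prod_i moment (N / n%:R) (deg S i).
Proof.
move=> d N0 Nn /andP[d0 d1]; set lam := n%:R * _ / _; set s := Num.sqrt _.
set q := N / n%:R.
have sn0 : s != 0 by rewrite gt_eqF // sqrtr_gt0 mulr_gt0 // subr_gt0.
rewrite /expect; under [LHS]eq_bigr => A _ do rewrite /P1 mulr_suml.
rewrite exchange_big /=.
pose w (X : {ffun 'I_n -> bool}) i := bern q (X i) * ((X i)%:R - q) ^+ deg S i.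
(* With the labels fixed the edges are independent, so the graph is summed out first; the rank-one
   kernel then leaves a product over vertices. *)
transitivity (\sum_(X : {ffun 'I_n -> bool}) (lam / s) ^+ #|S| * \prod_i w X i).
  apply: eq_bigr => X _.
  pose p (e : edge n) := edge_prob a (b_par n a c N) c (X (val e).1) (X (val e).2).
  under eq_bigr => A _ do rewrite -mulrA.
  rewrite -mulr_sumr.
  have -> : \sum_(A : graph n) (\prod_e bern (p e) (A e)) * chi d S A =
      \prod_(e in S) ((p e - d) / s).
    pose g (e : edge n) b := bern (p e) b *
      (if e \in S then (b%:R - d) / s else 1).
    transitivity (\sum_(A : graph n) \prod_e g e (A e)).
      by apply: eq_bigr => A _; rewrite /chi (big_mkcond (mem S)) -big_split.
    rewrite sum_prod_bool [RHS]big_mkcond; apply: eq_bigr => e _ /=.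
    by rewrite /g /bern; case: (e \in S); rewrite /=; field.
  under [X in _ * X = _]eq_bigr => e _.
    rewrite /p edge_prob_centred // -/q -/lam mulrAC.
    over.
  rewrite big_split /= prodr_const (prod_endpoints S (fun i => (X i)%:R - q)).
  by rewrite mulrCA /w big_split.
rewrite -mulr_sumr; congr (_ * _).
rewrite (sum_prod_bool (fun i b => bern q b * (b%:R - q) ^+ deg S i)).
by apply: eq_bigr => i _; rewrite /bern /moment sub0r.
Qed.

Lemma moment0 {R : realType} (q : R) : moment q 0 = 1.
Proof. by rewrite /moment !expr0; ring. Qed.

Lemma moment1 {R : realType} (q : R) : moment q 1 = 0.
Proof. by rewrite /moment !expr1; ring. Qed.

(** For [k >= 2] the two terms of the moment are, in absolute value, at most [q (1 - q)] and
    [(1 - q) q^2 <= q^2], which add up to [q]. *)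
Lemma moment_sqr_le {R : realType} (q : R) (k : nat) :
  0 <= q <= 1 -> (1 < k)%N -> moment q k ^+ 2 <= q ^+ 2.
Proof.
move=> /andP[q0 q1] k1; rewrite -[_ ^+ 2]real_normK ?num_real //.
rewrite ler_pXn2r ?nnegrE //.
apply: le_trans (ler_normD _ _) _.
have p0 : 0 <= 1 - q by rewrite subr_ge0.
have p1 : 1 - q <= 1 by rewrite lerBlDr lerDl.
rewrite !normrM !normrX normrN !ger0_norm //.
have Hp : (1 - q) ^+ k <= 1 - q.
  by rewrite -[leRHS]expr1 ler_wiXn2l // ltnW.
have Hq : q ^+ k <= q ^+ 2 by rewrite ler_wiXn2l.
have H1 := ler_wpM2l q0 Hp; have H2 := ler_wpM2l p0 Hq.
have H3 : (1 - q) * q ^+ 2 <= q * q by rewrite -expr2 ler_piMl ?sqr_ge0.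
lra.
Qed.

(** * Counting edge sets by the vertices they touch *)

Definition support_set {n : nat} (S : {set edge n}) : {set 'I_n} :=
  [set i | (0 < deg S i)%N].

Lemma sum_deg {n : nat} (S : {set edge n}) : (\sum_i deg S i = #|S| * 2)%N.
Proof.
rewrite /deg exchange_big /= -sum_nat_const; apply: eq_bigr => e _.
have one (j : 'I_n) : (\sum_(i < n) (j == i) = 1)%N.
  by rewrite (bigD1 j) //= eqxx big1 // => i ij; rewrite eq_sym (negbTE ij).
by rewrite /endpoint big_split /= !one.
Qed.

(** Every touched vertex has degree at least 2, while the degrees sum to [2 |S|]. *)
Lemma card_support_le {n : nat} (S : {set edge n}) :
  (forall i, deg S i != 1%N) -> (#|support_set S| <= #|S|)%N.
Proof.
move=> H; rewrite -(@leq_pmul2r 2) // -sum_deg -sum_nat_const.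
rewrite big_mkcond /=; apply: leq_sum => i _; rewrite inE.
by have := H i; case: (deg S i) => [|[|k]].
Qed.

Lemma endpoint_support {n : nat} (S : {set edge n}) (e : edge n) (i : 'I_n) :
  e \in S -> (0 < endpoint e i)%N -> i \in support_set S.
Proof.
move=> eS ei; rewrite inE /deg (bigD1 e) //=.
exact: leq_trans ei (leq_addr _ _).
Qed.

Definition edges_in {n : nat} (V : {set 'I_n}) : {set edge n} :=
  [set e | ((val e).1 \in V) && ((val e).2 \in V)].

(** A crude bound suffices: dividing [|V|^2] by some [D >= |V|] leaves at most [|V|]. *)
Lemma card_edges_in {n : nat} (V : {set 'I_n}) : (#|edges_in V| <= #|V| * #|V|)%N.
Proof.
rewrite -cardsX -(card_imset _ val_inj); apply: subset_leq_card.
by apply/fintype.subsetP => _ /imsetP[e + ->]; rewrite !inE.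
Qed.

Lemma sub_edges_in {n : nat} (S : {set edge n}) : S \subset edges_in (support_set S).
Proof.
apply/fintype.subsetP => e eS; rewrite inE.
by rewrite !(@endpoint_support _ S e) // /endpoint eqxx // addn1.
Qed.

Lemma sum_subset_expr {R : realType} {I : finType} (E : {set I}) (x : R) :
  \sum_(S : {set I} | S \subset E) x ^+ #|S| = (1 + x) ^+ #|E|.
Proof.
rewrite -prodr_const [RHS]big_mkcond /=.
rewrite [RHS](eq_bigr (fun e => (if e \in E then x else 0) + 1)); last first.
  by move=> e _; case: (e \in E); rewrite ?add0r // addrC.
rewrite [RHS](@bigA_distr _ 0 1 *%R +%R) /= [LHS]big_mkcond /=; apply: eq_bigr => S _.
case: ifPn => [/fintype.subsetP SE|/subsetPn[e eS eE]]; last first.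
  by rewrite (bigD1 e) //= eS (negbTE eE) mul0r.
rewrite -prodr_const big_mkcond; apply: eq_bigr => e _ /=.
by case: ifPn => // /SE ->.
Qed.

(** A vertex of degree 1 contributes [moment q 1 = 0]. Otherwise [card_support_le] applies, so the
    degree condition can be relaxed to the comparison of cardinalities, which is all that the
    counting uses. *)
Lemma expect1_chi_sqr_le {R : realType} {n : nat} (a c N : R) (S : {set edge n}) :
  let d := d_par n a c N in 0 < N -> N < n%:R / 3 -> 0 < d < 1 ->
  expect (P1 a c N) (chi d S) ^+ 2 <=
  if (#|support_set S| <= #|S|)%N then
    ((n%:R * (a - c) / (n%:R - 2 * N)) ^+ 2 / (d * (1 - d))) ^+ #|S| *
    ((N / n%:R) ^+ 2) ^+ #|support_set S|
  else 0.
Proof.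
move=> d N0 Nn d01; have /andP[d0 d1] := d01.
rewrite expect1_chi // -/d; set lam := n%:R * _ / _; set q := N / n%:R.
have n0 : 0 < n%:R :> R by lra.
have q01 : 0 <= q <= 1.
  by rewrite /q ler_pdivrMr // mul1r divr_ge0 /=; lra.
have tE : (lam / Num.sqrt (d * (1 - d))) ^+ 2 = lam ^+ 2 / (d * (1 - d)).
  by rewrite expr_div_n sqr_sqrtr // mulr_ge0 ?subr_ge0 // ltW.
case: (boolP [forall i, deg S i != 1%N]) => [/forallP H|].
  rewrite card_support_le // exprMn [X in X * _ <= _]exprAC tE.
  apply: ler_wpM2l.
    by rewrite exprn_ge0 // divr_ge0 ?sqr_ge0 // mulr_ge0 ?subr_ge0 // ltW.
  rewrite -prodrXl -prodr_const [leRHS]big_mkcond /=.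
  apply: ler_prod => i _; rewrite sqr_ge0 /= inE.
  have := H i; case: (deg S i) => [|[|k]] //= _.
    by rewrite moment0 expr1n.
  exact: moment_sqr_le.
rewrite negb_forall => /existsP[i]; rewrite negbK => /eqP di.
rewrite (bigD1 i) //= di moment1 mul0r mulr0 expr0n /=.
case: ifP => // _; rewrite mulr_ge0 ?exprn_ge0 ?sqr_ge0 //.
  by rewrite divr_ge0 ?sqr_ge0 // mulr_ge0 ?subr_ge0 // ltW.
by case/andP: q01.
Qed.

(* Since [t * D <= 1] and [#|V| <= #|S|], [t ^+ #|S|] is at most
   [(t * D) ^+ #|V| * D%:R^-1 ^+ #|S|], and the weights [D%:R^-1 ^+ #|S|] of
   all the edge sets inside [V] sum to at most [e ^+ #|V|]. *)
Lemma sum_support_le {R : realType} {n : nat} (D : nat) (t y : R) :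
  (0 < D)%N -> 0 <= t -> 0 <= y -> t * D%:R <= 1 ->
  \sum_(S : {set edge n} | (0 < #|S| <= D)%N)
    (if (#|support_set S| <= #|S|)%N then t ^+ #|S| * y ^+ #|support_set S| else 0)
  <= expR (n%:R * (y * (t * D%:R) * expR 1)) - 1.
Proof.
move=> D0 t0 y0 tD; have DR : 0 < D%:R :> R by rewrite ltr0n.
set w : R := D%:R^-1; have w0 : 0 <= w by rewrite invr_ge0 ltW.
set x := y * (t * D%:R) * expR 1.
have tD0 : 0 <= t * D%:R by rewrite mulr_ge0 // ltW.
have x0 : 0 <= x by rewrite !mulr_ge0 ?expR_ge0.
rewrite (partition_big (@support_set n) predT) //=.
apply: (@le_trans _ _ (\sum_(V : {set 'I_n} | V != finset.set0) x ^+ #|V|)).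
  rewrite [leRHS]big_mkcond /=; apply: ler_sum => V _.
  have [->|V0] /= := eqVneq V finset.set0.
    rewrite big1 // => S /andP[/andP[/card_gt0P[e eS] _] /eqP S0].
    have := @endpoint_support _ _ _ (val e).1 eS.
    by rewrite S0 inE /endpoint eqxx => /(_ isT).
  (* If [|V| > D >= |S|], the [if] takes its zero branch, so only [|V| <= D] remains. *)
  have [VD|VD] := leqP #|V| D; last first.
    rewrite big1 ?exprn_ge0 // => S /andP[/andP[_ SD] /eqP VS].
    by rewrite VS leqNgt (leq_ltn_trans SD VD).
  apply: (@le_trans _ _ (\sum_(S : {set edge n} | S \subset edges_in V)
      (y * (t * D%:R)) ^+ #|V| * w ^+ #|S|)).
    rewrite [leLHS]big_mkcond [leRHS]big_mkcond /=; apply: ler_sum => S _.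
    have r0 : 0 <= (y * (t * D%:R)) ^+ #|V| * w ^+ #|S|.
      by rewrite mulr_ge0 ?exprn_ge0 ?mulr_ge0.
    case: ifP => [/andP[_ /eqP VS]|_]; last by case: ifP.
    rewrite -VS sub_edges_in VS; case: ifP => // VleS.
    rewrite exprMn -mulrA mulrC; apply: ler_wpM2l; first exact: exprn_ge0.
    have -> : t ^+ #|S| = (t * D%:R) ^+ #|S| * w ^+ #|S|.
      by rewrite -exprMn mulfK // gt_eqF.
    apply: ler_wpM2r; first exact: exprn_ge0.
    by rewrite ler_wiXn2l.
  rewrite -mulr_sumr sum_subset_expr /x [leRHS]exprMn.
  apply: ler_wpM2l; first by rewrite exprn_ge0 ?mulr_ge0.
  rewrite -expRM_natl mulr1.
  apply: (@le_trans _ _ (expR w ^+ #|edges_in V|)).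
    by apply: lerXn2r; rewrite ?nnegrE ?expR_ge0 ?addr_ge0 // expR_ge1Dx.
  rewrite -expRM_natl ler_expR ler_pdivrMr // -natrM ler_nat.
  exact: leq_trans (card_edges_in V) (leq_mul _ _).
rewrite lerBrDr.
(* The subtracted 1 is the term of the empty vertex set; with it the sum is binomial, and
   [1 + x <= e^x] finishes. *)
have -> : \sum_(V : {set 'I_n} | V != finset.set0) x ^+ #|V| + 1 = (1 + x) ^+ n.
  have := sum_subset_expr (finset.setT : {set 'I_n}) x.
  rewrite cardsT card_ord => <-.
  rewrite [RHS](bigD1 finset.set0) /= ?finset.sub0set // cards0 expr0 addrC.
  by congr (_ + _); apply: eq_bigl => V; rewrite finset.subsetT.
by rewrite expRM_natl; apply: lerXn2r; rewrite ?nnegrE ?expR_ge0 ?addr_ge0 ?expR_ge1Dx.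
Qed.

(** * From first moments of the basis to admissible polynomials *)

Lemma expect_sum {R : realType} {n : nat} {I : finType} (P : graph n -> R)
    (k : I -> R) (g : I -> graph n -> R) (f : graph n -> R) :
  (forall A, f A = \sum_i k i * g i A) ->
  expect P f = \sum_i k i * expect P (g i).
Proof.
move=> fE; rewrite /expect; under eq_bigr => A _ do rewrite fE mulr_sumr.
rewrite exchange_big /=; apply: eq_bigr => i _; rewrite mulr_sumr.
by apply: eq_bigr => A _; rewrite mulrCA.
Qed.

Lemma expect_chi {R : realType} {n : nat} (a c N : R) (T : {set edge n}) :
  let d := d_par n a c N in 0 < d < 1 ->
  expect (P0 a c N) (chi d T) = (T == finset.set0)%:R.
Proof.
move=> d d01; rewrite -(expect_chiM _ _ _ _ _ d01); apply: eq_bigr => A _.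
by rewrite {3}/chi big_set0 mulr1.
Qed.

(** Mean zero removes the coefficient of the empty set, and unit variance makes the coefficients a
    unit vector, to be paired with the vector of first moments. *)
Lemma expect1_admissible_le {R : realType} {n : nat} (D : nat) (a c N eta : R)
    (f : graph n -> R) :
  let d := d_par n a c N in 0 < d < 1 -> 0 < eta ->
  \sum_(S : {set edge n} | (0 < #|S| <= D)%N)
    expect (P1 a c N) (chi d S) ^+ 2 <= eta ^+ 2 ->
  admissible D a c N f -> expect (P1 a c N) f <= eta.
Proof.
move=> d d01 eta0 Gle [fpoly [f0 fvar]].
have [gam [gamD fE]] := @chi_expansion _ _ _ _ _ d01 fpoly.
have Echi T := expect_chi a c N T d01.
have gam0 : gam finset.set0 = 0.
  have := expect_sum (P0 a c N) _ _ f fE.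
  rewrite f0 (bigD1 finset.set0) //= Echi eqxx mulr1 => ->.
  by rewrite big1 ?addr0 // => T /negbTE T0; rewrite Echi T0 mulr0.
have gam2 : \sum_T gam T ^+ 2 = 1.
  move: fvar; rewrite /Defs.variance f0 expr0n subr0 => <-.
  have f2E A : f A ^+ 2 = \sum_T gam T * (f A * chi d T A).
    rewrite expr2 {2}fE mulr_sumr; apply: eq_bigr => T _.
    by rewrite mulrCA.
  rewrite (expect_sum _ _ _ _ f2E); apply: eq_bigr => T _.
  rewrite expr2; congr (_ * _).
  have fTE A : f A * chi d T A = \sum_S gam S * (chi d S A * chi d T A).
    by rewrite fE mulr_suml; apply: eq_bigr => S _; rewrite mulrA.
  rewrite (expect_sum _ _ _ _ fTE) (bigD1 T) //= expect_chiM // eqxx mulr1.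
  rewrite big1 ?addr0 // => S /negbTE ST.
  by rewrite expect_chiM // ST mulr0.
set G := \sum_(S | _) _ in Gle.
have -> : expect (P1 a c N) f =
    \sum_(S : {set edge n} | (0 < #|S| <= D)%N) gam S * expect (P1 a c N) (chi d S).
  rewrite (expect_sum _ _ _ f fE) [RHS]big_mkcond /=; apply: eq_bigr => S _.
  case: ifP => // /negbT; rewrite negb_and -eqn0Ngt cards_eq0 -ltnNge.
  by case/orP => [/eqP ->|/gamD ->]; rewrite ?gam0 mul0r.
(* Cauchy-Schwarz in weighted form, without square roots: summed with weight [eta], it gives at most
   [(eta + eta^2 / eta) / 2 = eta]. *)
have amgm (x y : R) : x * y <= (eta * x ^+ 2 + y ^+ 2 / eta) / 2.
  have e0 : eta != 0 by rewrite gt_eqF.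
  have -> : (eta * x ^+ 2 + y ^+ 2 / eta) / 2 =
    x * y + (eta * x - y) ^+ 2 / (2 * eta) by field.
  by rewrite lerDl divr_ge0 ?sqr_ge0 // mulr_ge0 // ltW.
apply: le_trans (ler_sum _ (fun S _ => amgm _ _)) _.
rewrite -mulr_suml big_split /= -mulr_sumr -mulr_suml -/G.
have gle : \sum_(S : {set edge n} | (0 < #|S| <= D)%N) gam S ^+ 2 <= 1.
  by rewrite -gam2 big_mkcond /=; apply: ler_sum => S _; case: ifP; rewrite ?sqr_ge0.
have h1 : G / eta <= eta by rewrite ler_pdivrMr // -expr2.
have h2 := ler_wpM2l (ltW eta0) gle.
lra.
Qed.

(** Provides the lower bound 0 for the supremum, which would be [-oo] over an empty set. The witness
    is one normalised edge: its endpoints have degree 1, so its planted mean vanishes. *)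
Lemma exists_admissible {R : realType} {n : nat} (D : nat) (a c N : R) :
  (0 < D)%N -> (1 < n)%N -> 0 < N -> N < n%:R / 3 -> 0 < d_par n a c N < 1 ->
  exists2 f : graph n -> R,
    admissible D a c N f & expect (P1 a c N) f = 0.
Proof.
move=> D0 n1 N0 Nn d01; set d := d_par n a c N.
have e : edge n.
  by apply: (exist _ (Ordinal (ltnW n1), Ordinal n1)) => /=.
exists (chi d [set e]%SET); last first.
  rewrite expect1_chi // (bigD1 (val e).1) //= {1}/deg big_set1 /endpoint eqxx.
  rewrite (_ : (val e).2 == (val e).1 = false) ?moment1 ?mul0r ?mulr0 //.
  by apply/negbTE; rewrite -val_eqE gtn_eqF // (valP e).
have Echi T := expect_chi a c N T d01.
have e0 : ([set e]%SET == finset.set0) = false.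
  by apply/negbTE/set0Pn; exists e; rewrite inE.
split; last split; last 1 first.
- rewrite /Defs.variance Echi e0 expr0n subr0.
  by have := expect_chiM a c N [set e]%SET [set e]%SET d01; rewrite eqxx.
- set s := Num.sqrt (d * (1 - d)).
  exists (fun S => if S == finset.set0 then - d / s
                   else if S == [set e]%SET then s^-1 else 0) => A.
  rewrite (bigD1 finset.set0) ?cards0 //= eqxx big_set0 mulr1.
  rewrite (bigD1 [set e]%SET) ?cards1 ?D0 ?e0 //= eqxx big_set1.
  rewrite big1 => [|S /andP[/andP[_ /negbTE ->] /negbTE ->]]; last by rewrite mul0r.
  by rewrite /chi big_set1 -/s addr0 mulrC mulrBr mulNr addrC mulrC [d / s]mulrC.
- by rewrite Echi e0.
Qed.

(** * Parameter estimates and the bound for fixed [n] *)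

(** With [q = N/n <= 1/3], [d] is the average [(1 - q) c + q b], and [c < a] forces [b <= c]. *)
Lemma d_par_bounds {R : realType} {n : nat} (a c N : R) :
  0 < c -> c < a -> 0 <= b_par n a c N -> 0 < N -> N < n%:R / 3 ->
  2 / 3 * c <= d_par n a c N <= c.
Proof.
move=> c0 ca b0 N0 Nn; have n0 : 0 < n%:R :> R by lra.
have n1 : 0 < n%:R - 2 * N by lra.
have q3 : N / n%:R <= 1 / 3 by rewrite ler_pdivrMr //; lra.
have q0 : 0 <= N / n%:R by rewrite divr_ge0 // ltW.
have dE : d_par n a c N = c - (c - b_par n a c N) * (N / n%:R).
  by rewrite /d_par /b_par; field; rewrite !gt_eqF.
have bc : b_par n a c N <= c.
  rewrite /b_par ler_pdivrMr //.
  have h : c * N < a * N by rewrite ltr_pM2r.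
  lra.
rewrite dE; set b := b_par n a c N in b0 bc *; set q := N / n%:R in q3 q0 *.
apply/andP; split; nra.
Qed.

(** Since [n - 2 N > n/3], the squared numerator is at most [9 (a - c)^2]; the denominator is at
    least [(2/3) c delta]. Hence the constant [9 * 3/2 = 27/2] over [delta]. *)
Lemma chi_ratio_le {R : realType} {n : nat} (a c N delta : R) :
  let d := d_par n a c N in
  0 < delta -> 0 < c -> c < a -> c < 1 - delta -> 0 <= b_par n a c N ->
  0 < N -> N < n%:R / 3 ->
  (n%:R * (a - c) / (n%:R - 2 * N)) ^+ 2 / (d * (1 - d)) <=
  27 / (2 * delta) * ((a - c) / Num.sqrt c) ^+ 2.
Proof.
move=> d del0 c0 ca c1 b0 N0 Nn.
have /andP[d1 d2] := d_par_bounds _ _ _ c0 ca b0 N0 Nn; rewrite -/d in d1 d2.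
have n1 : 0 < n%:R - 2 * N by lra.
have ac0 : 0 < a - c by rewrite subr_gt0.
set lam := n%:R * _ / _.
have lam0 : 0 <= lam by rewrite /lam divr_ge0 ?mulr_ge0 // ltW.
have lam3 : lam <= 3 * (a - c) by rewrite /lam ler_pdivrMr //; nra.
have lam9 : lam ^+ 2 <= 9 * (a - c) ^+ 2 by nra.
have dd : 2 / 3 * c * delta <= d * (1 - d) by nra.
have dd0 : 0 < 2 / 3 * c * delta by nra.
rewrite [((a - c) / _) ^+ 2]expr_div_n (sqr_sqrtr (ltW c0)) ler_pdivrMr;
  last exact: lt_le_trans dd.
have -> : 27 / (2 * delta) * ((a - c) ^+ 2 / c) * (d * (1 - d)) =
  9 * (a - c) ^+ 2 * ((d * (1 - d)) / (2 / 3 * c * delta)).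
  by field; rewrite !gt_eqF.
apply: le_trans lam9 _; rewrite -[leLHS]mulr1.
apply: ler_wpM2l; first by rewrite mulr_ge0 // sqr_ge0.
by rewrite ler_pdivlMr // mul1r.
Qed.

(** The first smallness hypothesis ensures [t D <= 1] in [sum_support_le]; the second makes the
    resulting bound at most [eta^2], because [n (N/n)^2 = (N / sqrt n)^2]. *)
Lemma expect1_le_of_small {R : realType} {n : nat} (D : nat) (a c N delta eta : R)
    (f : graph n -> R) :
  let r := (a - c) / Num.sqrt c in let K := 27 / (2 * delta) in
  0 < delta -> 0 < c -> c < a -> c < 1 - delta -> 0 <= b_par n a c N ->
  0 < N -> N < n%:R / 3 -> (0 < D)%N -> 0 < eta ->
  K * r ^+ 2 * D%:R <= 1 ->
  expR (K * (N / Num.sqrt n%:R * r) ^+ 2 * D%:R * expR 1) <= 1 + eta ^+ 2 ->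
  admissible D a c N f -> expect (P1 a c N) f <= eta.
Proof.
move=> r K del0 c0 ca c1 b0 N0 Nn D0 eta0 small1 small2 fadm.
have tle := chi_ratio_le _ _ _ _ del0 c0 ca c1 b0 N0 Nn.
have /andP[d1 d2] := d_par_bounds _ _ _ c0 ca b0 N0 Nn.
have d01 : 0 < d_par n a c N < 1 by apply/andP; split; nra.
have /andP[dp dl] := d01.
have n0 : 0 < n%:R :> R by lra.
apply: expect1_admissible_le fadm => //.
set t := _ ^+ 2 / _ in tle; rewrite -/K -/r in tle.
have t0 : 0 <= t.
  by rewrite /t divr_ge0 ?sqr_ge0 // mulr_ge0 ?subr_ge0 // ltW.
have tD : t * D%:R <= K * r ^+ 2 * D%:R by rewrite ler_wpM2r ?ler0n.
apply: le_trans (ler_sum _ (fun S _ => expect1_chi_sqr_le _ _ _ S N0 Nn d01)) _.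
have := @sum_support_le _ n D t _ D0 t0 (sqr_ge0 (N / n%:R)) (le_trans tD small1).
move=> /le_trans; apply.
rewrite lerBlDl; apply: le_trans small2; rewrite ler_expR mulrA.
apply: ler_wpM2r; first exact: expR_ge0.
have -> : n%:R * ((N / n%:R) ^+ 2 * (t * D%:R)) = N ^+ 2 / n%:R * (t * D%:R).
  by field; rewrite gt_eqF.
have -> : K * (N / Num.sqrt n%:R * r) ^+ 2 * D%:R =
    N ^+ 2 / n%:R * (K * r ^+ 2 * D%:R).
  rewrite exprMn [(N / _) ^+ 2]expr_div_n (sqr_sqrtr (ltW n0)); ring.
by apply: ler_wpM2l => //; rewrite divr_ge0 ?sqr_ge0 // ltW.
Qed.


(** * Asymptotics in [L = ln n] *)

Lemma expRN_le_sqr {R : realType} (x : R) : 0 < x -> x ^+ 2 * expR (- x) <= 2.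
Proof.
move=> x0; rewrite expRN ler_pdivrMr ?expR_gt0 //.
have := expR_ge1Dxn 1 (ltW x0); rewrite (_ : 2`!%:R = 2) //; lra.
Qed.

Lemma expRN_le_cube {R : realType} (x : R) : 0 < x -> x ^+ 3 * expR (- x) <= 6.
Proof.
move=> x0; rewrite expRN ler_pdivrMr ?expR_gt0 //.
have := expR_ge1Dxn 2 (ltW x0); rewrite (_ : 3`!%:R = 6) //; lra.
Qed.

(** As [sqrt (D/2 - 1) <= M] and [M^2 = C L], the second term of the maximum yields
    [ln r <= - eps L / M = - eps M / C]. This decay is exponential only in [sqrt L], yet it still
    beats a factor [D = O(L)]. *)
Lemma exponent_bounds {R : realType} (D : nat) (C L u r eps : R) :
  0 < C -> 0 < L -> 0 < eps -> 0 < u -> 0 < r -> D%:R <= C * L ->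
  Num.max (ln u / L + ln r / L) (Num.sqrt (D%:R / 2 - 1) * (ln r / L)) <= - eps ->
  let M := Num.sqrt (C * L) in
  [/\ (0 < D)%N, (u * r) ^+ 2 <= expR (- (2 * eps * L)) &
      r ^+ 2 <= expR (- (2 * eps * M / C))].
Proof.
move=> C0 L0 eps0 u0 r0 DL; rewrite ge_max => /andP[h1 h2] M.
have CL0 : 0 < C * L by rewrite mulr_gt0.
have M0 : 0 < M by rewrite sqrtr_gt0.
have M2 : M ^+ 2 = C * L by rewrite sqr_sqrtr // ltW.
have s0 : 0 <= Num.sqrt (D%:R / 2 - 1 : R) := sqrtr_ge0 _.
(* At [D = 0] the square root of a negative number is 0 by convention, so the second term would be
   0, not at most [- eps]. *)
have D0 : (0 < D)%N.
  case: (posnP D) => // D0; move: h2.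
  by rewrite D0 ler0_sqrtr ?mul0r; lra.
have sM : Num.sqrt (D%:R / 2 - 1) <= M.
  by have DR : 0 <= D%:R :> R by []; apply: ler_wsqrtr; lra.
have sqr_expR (x y : R) : 0 < x -> ln x <= y -> x ^+ 2 <= expR (2 * y).
  move=> x0 xy; rewrite -[x]lnK ?posrE // -expRM_natl ler_expR.
  by rewrite ler_pM2l.
split=> //.
  have -> : - (2 * eps * L) = 2 * (- eps * L) by ring.
  apply: sqr_expR; first exact: mulr_gt0.
  rewrite lnM ?posrE // -ler_pdivrMr //; lra.
have -> : - (2 * eps * M / C) = 2 * (- eps * M / C) by ring.
apply: sqr_expR => //.
set z := ln r / L in h2.
(* The sign matters: only for negative [z] may the square root be replaced by the larger [M]. *)
have z0 : z < 0 by rewrite ltNge; apply/negP => z0; have := mulr_ge0 s0 z0; lra.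
have Mz : M * z <= - eps by nra.
have -> : ln r = z * L by rewrite /z divfK // gt_eqF.
have -> : L = M * M / C by rewrite -expr2 M2 mulrC mulKf // gt_eqF.
rewrite !mulrA; apply: ler_wpM2r; first by rewrite invr_ge0 ltW.
by apply: ler_wpM2r; [exact: ltW | rewrite mulrC].
Qed.

Lemma near_ln_ge {R : realType} (B : R) : \forall n \near \oo, B <= ln (n%:R : R).
Proof.
near=> n; have h : expR B <= n%:R by near: n; exact: nbhs_infty_ger.
by rewrite -[B]expRK ler_ln ?posrE ?expR_gt0 // (lt_le_trans _ h) ?expR_gt0.
Unshelve. all: by end_near. Qed.

(** The limsup is an infimum, over eventual sets [V], of suprema over [V]; if it is negative, one
    such supremum is negative and provides the uniform gap. *)
Lemma near_lt_of_limn_esup_lt0 {R : realType} (u : nat -> R) :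
  (limn_esup (fun n => (u n)%:E) < 0)%E ->
  exists2 eps : R, 0 < eps & \forall n \near \oo, u n <= - eps.
Proof.
move=> /ereal_inf_lt [_ [V FV <-] supV].
suff [eps e0 He] : exists2 eps : R, 0 < eps & forall n, V n -> u n <= - eps.
  by exists eps => //; apply: filterS FV => n /He.
have ub n : V n -> ((u n)%:E <= ereal_sup [set (u x)%:E | x in V])%E.
  by move=> Vn; apply: ereal_sup_ubound; exists n.
move: supV ub; case: (ereal_sup _) => [s| |] //.
- rewrite lte_fin => s0 ub; exists (- s); first by rewrite oppr_gt0.
  by move=> n /ub; rewrite lee_fin opprK.
(* A supremum [-oo] leaves no [n] in [V], so the value 1 is arbitrary. *)
- by move=> _ ub; exists 1 => // n /ub; rewrite leeNy_eq.
Qed.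

Lemma exponential_decay {R : realType} (C eps K h : R) :
  0 < C -> 0 < eps -> 0 < K -> 0 < h ->
  exists B : R, forall L, B <= L ->
    [/\ 0 < L, K * (C * L) * expR (- (2 * eps * Num.sqrt (C * L) / C)) <= 1 &
        K * (C * L) * expR (- (2 * eps * L)) <= h].
Proof.
move=> C0 eps0 K0 h0.
(* With [M = sqrt (C L)], the bound [x^3 e^(-x) <= 6] at [x = 2 eps M / C] makes the first quantity
   at most [B1 / M], and [x^2 e^(-x) <= 2] at [x = 2 eps L] makes the second at most [h B2 / L]. *)
pose B1 := 6 * K * C ^+ 3 / (8 * eps ^+ 3).
pose B2 := K * C / (2 * eps ^+ 2 * h).
exists (Num.max 1 (Num.max (B1 ^+ 2 / C) B2)) => L.
rewrite !ge_max => /andP[L1 /andP[LB1 LB2]].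
have L0 : 0 < L by lra.
have CL0 : 0 < C * L by rewrite mulr_gt0.
split=> //.
- set M := Num.sqrt _; have M0 : 0 < M by rewrite sqrtr_gt0.
  have M2 : M ^+ 2 = C * L by rewrite sqr_sqrtr // ltW.
  have B10 : 0 <= B1 by rewrite /B1 divr_ge0 ?mulr_ge0 ?exprn_ge0 // ltW.
  have BM : B1 <= M.
    rewrite -(@ler_pXn2r _ 2) ?nnegrE ?(ltW M0) // M2.
    by rewrite [leRHS]mulrC -ler_pdivrMr.
  set x := 2 * eps * M / C.
  have x0 : 0 < x by rewrite /x divr_gt0 ?mulr_gt0.
  have := expRN_le_cube _ x0; set E := expR _ => hE.
  have -> : K * (C * L) * E = K * C ^+ 3 / (8 * eps ^+ 3) * (x ^+ 3 * E) / M.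
    by rewrite -M2 /x; field; rewrite !gt_eqF.
  rewrite ler_pdivrMr // mul1r; apply: le_trans BM.
  have -> : B1 = K * C ^+ 3 / (8 * eps ^+ 3) * 6.
    by rewrite /B1; field; rewrite gt_eqF.
  by apply: ler_wpM2l => //; rewrite divr_ge0 ?mulr_ge0 ?exprn_ge0 // ltW.
- set x := 2 * eps * L; have x0 : 0 < x by rewrite /x !mulr_gt0.
  have := expRN_le_sqr _ x0; set E := expR _ => hE.
  have -> : K * (C * L) * E = K * C / (4 * eps ^+ 2) * (x ^+ 2 * E) / L.
    by rewrite /x; field; rewrite !gt_eqF.
  rewrite ler_pdivrMr //.
  have hL : K * C / (4 * eps ^+ 2) * 2 <= h * L.
    have -> : K * C / (4 * eps ^+ 2) * 2 = h * B2.
      by rewrite /B2; field; rewrite !gt_eqF.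
    by rewrite ler_pM2l.
  apply: le_trans hL; apply: ler_wpM2l => //.
  by rewrite divr_ge0 ?mulr_ge0 ?exprn_ge0 // ltW.
Qed.

Theorem theorem6 (R : realType) (a c N : nat -> R) (D : nat -> nat) (delta : R) :
  0 < delta ->
  (\forall n \near \oo,
      [/\ 0 < c n, c n < a n, c n < 1 - delta,
          0 <= b_par n (a n) (c n) (N n) & 0 < N n /\ N n < n%:R / 3]) ->
  (exists C : R, \forall n \near \oo, (D n)%:R <= C * ln (n%:R : R)) ->
  (limn_esup (fun n : nat =>
      (Num.max
        (logn_ n (N n / Num.sqrt n%:R) + logn_ n ((a n - c n) / Num.sqrt (c n)))
        (Num.sqrt ((D n)%:R / 2 - 1) * logn_ n ((a n - c n) / Num.sqrt (c n))))%:E)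
     < 0)%E ->
  (fun n : nat =>
     ereal_sup [set (expect (P1 (a n) (c n) (N n)) f)%:E
               | f in [set f : graph n -> R | admissible (D n) (a n) (c n) (N n) f]])
    @ \oo --> 0%E.
Proof.
move=> del0 Hpar [C0 HD0] /near_lt_of_limn_esup_lt0[eps eps0 Hmax].
(* The given constant may fail to be positive, and later bounds divide by it. *)
pose C := Num.max C0 1; have C1 : 0 < C by rewrite lt_max ltr01 orbT.
set s := fun n => ereal_sup _.
(* Eventual bounds for every [eta] suffice: [eta = 1] gives finiteness, after which the limit is
   taken among the reals. *)
suff bound eta : 0 < eta -> \forall n \near \oo, (0 <= s n <= eta%:E)%E.
  apply/fine_cvgP; split.
    near=> n; have /andP[s0 s1] : (0 <= s n <= 1%:E)%E by near: n; exact: bound.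
    by rewrite ge0_fin_numE // (le_lt_trans s1) // ltry.
  apply/cvgr0Pnorm_le => e e0; near=> n.
  have /andP[s0 s1] : (0 <= s n <= e%:E)%E by near: n; exact: bound.
  have sfin : s n \is a fin_num by rewrite ge0_fin_numE // (le_lt_trans s1) // ltry.
  by rewrite /= ger0_norm ?fine_ge0 // -lee_fin fineK.
move=> eta0; pose K := 27 / (2 * delta); have K0 : 0 < K by rewrite divr_gt0 ?mulr_gt0.
(* The threshold under which the exponent, including its factor [e], stays below
   [ln (1 + eta^2)]. *)
have h0 : 0 < ln (1 + eta ^+ 2) / expR 1.
  by rewrite divr_gt0 ?expR_gt0 // ln_gt0 // ltrDl exprn_gt0.
have [B HB] := exponential_decay _ _ _ _ C1 eps0 K0 h0.
near=> n.
have [c0 ca cd b0 [N0 Nn]] : [/\ 0 < c n, c n < a n, c n < 1 - delta,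
    0 <= b_par n (a n) (c n) (N n) & 0 < N n /\ N n < n%:R / 3] by near: n.
have BL : B <= ln (n%:R : R) by near: n; exact: near_ln_ge.
have DL0 : (D n)%:R <= C0 * ln (n%:R : R) by near: n.
have maxle : Num.max
    (logn_ n (N n / Num.sqrt n%:R) + logn_ n ((a n - c n) / Num.sqrt (c n)))
    (Num.sqrt ((D n)%:R / 2 - 1) * logn_ n ((a n - c n) / Num.sqrt (c n))) <= - eps
  by near: n.
have [L0 decay1 decay2] := HB _ BL.
set L := ln (n%:R : R) in L0 decay1 decay2 DL0.
have DL : (D n)%:R <= C * L.
  by apply: le_trans DL0 _; rewrite ler_pM2r // le_max lexx.
have nR : 0 < n%:R :> R by lra.
have r0 : 0 < (a n - c n) / Num.sqrt (c n) by rewrite divr_gt0 ?subr_gt0 ?sqrtr_gt0.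
have u0 : 0 < N n / Num.sqrt n%:R by rewrite divr_gt0 ?sqrtr_gt0.
have [D0 ur rb] := exponent_bounds _ _ _ _ _ _ C1 L0 eps0 u0 r0 DL maxle.
have n1 : (1 < n)%N.
  by rewrite ltnNge; apply/negP => n1; move: L0; rewrite /L ltNge ln_le0 // lern1.
have /andP[d1 d2] := d_par_bounds _ _ _ c0 ca b0 N0 Nn.
apply/andP; split.
  have [|f fadm f0] := exists_admissible (D n) (a n) (c n) (N n) D0 n1 N0 Nn.
    by apply/andP; split; nra.
  by apply: ereal_sup_ubound; exists f => //; rewrite f0.
apply: ge_ereal_sup => _ [f fadm <-]; rewrite lee_fin.
apply: (expect1_le_of_small _ _ _ _ _ _ _ del0 c0 ca cd b0 N0 Nn D0 eta0) fadm.
  apply: le_trans decay1; rewrite -/K [leRHS]mulrAC; apply: ler_pM => //.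
  - by rewrite mulr_ge0 ?sqr_ge0 // ltW.
  - by rewrite ler_pM2l.
rewrite -[leRHS]lnK ?posrE ?addr_gt0 ?exprn_gt0 // ler_expR -ler_pdivlMr ?expR_gt0 //.
apply: le_trans decay2; rewrite -/K [leRHS]mulrAC; apply: ler_pM => //.
- by rewrite mulr_ge0 ?sqr_ge0 // ltW.
- by rewrite ler_pM2l.
Unshelve. all: by end_near. Qed.
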